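(* Let $m\ge 1$, $I:=\{1,2,\dots,m\}$, let $T_i:\mathcal H\to\mathcal H$ be an $\alpha_i$-strict pseudocontraction, where $\alpha_i\in(-\infty,1)$, $i\in I$. Let $w_i>0$, $i\in I$, with $\sum_{i=1}^m w_i=1$, and let $T:=\sum_{i=1}^m w_iT_i$. Then: (i) $T$ is an $\alpha$-strict pseudocontraction with $$\alpha=1-\left(\sum_{i=1}^m\frac{w_i}{1-\alpha_i}\right)^{-1};$$ (ii) $-\infty<\min_{i\in I}\alpha_i\le\alpha\le\max_{i\in I}\alpha_i<1$.
   Context: $\mathcal H$ is a real Hilbert space with $\mathcal H\neq\{0\}$. For $\alpha\in(-\infty,1)$, an operator $T:\mathcal H\to\mathcal H$ is an $\alpha$-strict pseudocontraction if $\|T(x)-T(y)\|^2\le\|x-y\|^2+\alpha\|(T(x)-x)-(T(y)-y)\|^2$ for all $x,y\in\mathcal H$. *)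

(* Defs.v *)
From HB Require Import structures.
From mathcomp Require Import all_boot all_order all_algebra.
From mathcomp Require Import all_classical all_reals all_analysis.

Set Implicit Arguments.
Unset Strict Implicit.
Unset Printing Implicit Defensive.

Import Order.TTheory GRing.Theory Num.Theory.
Import numFieldNormedType.Exports.

Local Open Scope ring_scope.

(* A real Hilbert space is a complete normed module over [R] whose norm comes
   from a positive definite symmetric bilinear form: [{dot H for idfun}]
   consists of the bilinear forms on [H] that are symmetric (hermitian for the
   identity involution) and positive on nonzero vectors. *)
HB.mixin Record CompleteNormedModule_isHilbert (R : realType) (H : Type)
    of CompleteNormedModule R H := {
  inner : {dot H for (@idfun R)};
  sqr_norm_inner : forall x : H, `|x| ^+ 2 = inner x x
}.

#[short(type="hilbertType")]
HB.structure Definition Hilbert (R : realType) :=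
  { H of CompleteNormedModule R H & CompleteNormedModule_isHilbert R H }.

Definition strict_pseudocontraction (R : realType) (H : hilbertType R)
    (alpha : R) (T : H -> H) : Prop :=
  alpha < 1 /\
  forall x y : H,
    `|T x - T y| ^+ 2 <=
      `|x - y| ^+ 2 + alpha * `|(T x - x) - (T y - y)| ^+ 2.

(* Main.v *)
Require Import Defs.
From HB Require Import structures.
From mathcomp Require Import all_boot all_order all_algebra.
From mathcomp Require Import all_classical all_reals all_analysis.
From mathcomp Require Import ring lra.

(** For each pair [x], [y], let [r := (T x - x) - (T y - y)] be the difference
    of the displacements.  Since [T x - T y = (x - y) + r], expanding the square
    turns [alpha]-strict pseudocontractivity into
      [(1 - alpha) |r|^2 + 2 <x - y, r> <= 0].
    As the weights sum to one, the difference of displacements of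
    [T = \sum_i w_i T_i] is [r = \sum_i w_i r_i], so the inner product term is
    the weighted average of the inner product terms of the [T_i].  The remaining
    quadratic term is controlled by a weighted Cauchy-Schwarz inequality
    ([sqr_norm_wsum_le]) with [b_i = 1 - alpha_i]:
      [(\sum_i w_i / b_i)^-1 |r|^2 <= \sum_i w_i b_i |r_i|^2],
    and the constant on the left is [1 - alpha].

    For the bounds on [alpha], [(1 - alpha)^-1] is the weighted average of the
    numbers [(1 - alpha_i)^-1].  An average lies between two of the averaged
    values ([exists_ge_wavg], [exists_le_wavg]), and [a |-> (1 - a)^-1] is
    increasing on [a < 1]. *)

Import Order.TTheory GRing.Theory Num.Theory.
Import numFieldNormedType.Exports.

Local Open Scope ring_scope.

Lemma sqr_normD (R : realType) (H : hilbertType R) (u v : H) :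
  `|u + v| ^+ 2 = `|u| ^+ 2 + 2 * inner u v + `|v| ^+ 2.
Proof.
have innerC : inner v u = inner u v by rewrite (hermC inner v u) expr0 mul1r.
rewrite !sqr_norm_inner linearDl !linearDr /= innerC.
ring.
Qed.

Lemma sqr_normBZ (R : realType) (H : hilbertType R) (a b : R) (u v : H) :
  `|b *: u - a *: v| ^+ 2
  = b ^+ 2 * `|u| ^+ 2 - 2 * (a * b) * inner u v + a ^+ 2 * `|v| ^+ 2.
Proof.
rewrite sqr_normD linearNr linearZl_LR linearZr_LR /= normrN !normrZ !exprMn.
rewrite !real_normK ?num_real //.
ring.
Qed.

(** With [r := \sum_i w i *: r_ i] and [a] the constant on the left, the
    difference of the two sides is [\sum_i (w i / b i) |b i r_i - a r|^2]. *)
Lemma sqr_norm_wsum_le (R : realType) (H : hilbertType R) (I : finType)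
    (w b : I -> R) (r_ : I -> H) :
  (forall i, 0 <= w i) -> (forall i, 0 < b i) ->
  (\sum_i w i / b i)^-1 * `|\sum_i w i *: r_ i| ^+ 2
  <= \sum_i w i * b i * `|r_ i| ^+ 2.
Proof.
move=> w_ge0 b_gt0.
set S := \sum_i w i / b i; set r := \sum_i w i *: r_ i; set a := S^-1.
have sum_ge0 : 0 <= \sum_i w i / b i * `|b i *: r_ i - a *: r| ^+ 2.
  apply: sumr_ge0 => i _.
  by rewrite mulr_ge0 ?sqr_ge0 ?divr_ge0 ?w_ge0 // ltW.
(* Also valid in the degenerate case [S = 0], where [a = 0]. *)
have a2S : a ^+ 2 * S = a.
  by rewrite /a; have [->|S_neq0] := eqVneq S 0; [rewrite mulr0 invr0 | field].
have innerE : \sum_i w i * inner (r_ i) r = `|r| ^+ 2.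
  rewrite sqr_norm_inner {3}/r linear_sumlz.
  by apply: eq_bigr => i _; rewrite linearZl_LR.
have sumE : \sum_i w i / b i * `|b i *: r_ i - a *: r| ^+ 2
    = \sum_i w i * b i * `|r_ i| ^+ 2 - 2 * a * `|r| ^+ 2
      + a ^+ 2 * S * `|r| ^+ 2.
  rewrite -[in 2 * a * _]innerE /S [2 * a * _]mulr_sumr [a ^+ 2 * _]mulr_sumr.
  rewrite mulr_suml -sumrB -big_split /=; apply: eq_bigr => i _.
  rewrite sqr_normBZ; field; exact: lt0r_neq0.
by move: sum_ge0; rewrite sumE a2S; lra.
Qed.

(** Expand the square in [T x - T y = (x - y) + ((T x - x) - (T y - y))]. *)
Lemma strict_pseudocontractionP (R : realType) (H : hilbertType R)
    (alpha : R) (T : H -> H) :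
  strict_pseudocontraction alpha T <->
  alpha < 1 /\ forall x y : H,
    (1 - alpha) * `|(T x - x) - (T y - y)| ^+ 2
      + 2 * inner (x - y) ((T x - x) - (T y - y)) <= 0.
Proof.
have TE x y : T x - T y = (x - y) + ((T x - x) - (T y - y)).
  by rewrite opprB addrACA addKr [x + _]addrC subrK.
by split=> -[alpha_lt1 T_spc]; split=> // x y; move: (T_spc x y);
  rewrite TE (sqr_normD _ _ (x - y)); lra.
Qed.

Lemma exists_ge_wavg (R : realType) (I : finType) (w f : I -> R) :
  (forall i, 0 < w i) -> \sum_i w i = 1 ->
  exists i, \sum_j w j * f j <= f i.
Proof.
move=> w_gt0 w_sum1; set A := \sum_j w j * f j.
have /existsP[i Afi] : [exists i, A <= f i]; last by exists i.
apply: contraT; rewrite negb_exists => /forallP f_lt.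
(* If every [f i] were below [A], the sum of the positive numbers
   [w i * (A - f i)], which is zero, would have only zero terms. *)
have gap_gt0 i : 0 < w i * (A - f i) by rewrite mulr_gt0 // subr_gt0 ltNge.
have gap_sum0 : \sum_i w i * (A - f i) = 0.
  under eq_bigr do rewrite mulrBr.
  by rewrite sumrB -mulr_suml w_sum1 mul1r subrr.
have w0 i : w i = 0.
  have /eqP := psumr_eq0P (fun j _ => ltW (gap_gt0 j)) gap_sum0 (i := i) isT.
  by rewrite gt_eqF.
by move: w_sum1; rewrite big1 // => /esym/eqP; rewrite oner_eq0.
Qed.

Lemma exists_le_wavg (R : realType) (I : finType) (w f : I -> R) :
  (forall i, 0 < w i) -> \sum_i w i = 1 ->
  exists i, f i <= \sum_j w j * f j.
Proof.
move=> w_gt0 w_sum1.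
have [i] := @exists_ge_wavg R I w (fun j => - f j) w_gt0 w_sum1.
under eq_bigr do rewrite mulrN.
by rewrite sumrN lerN2; exists i.
Qed.

Theorem corollary3p2 (R : realType) (H : hilbertType R)
  (H_neq0 : exists x : H, x <> 0)
  (m : nat) (m_ge1 : (1 <= m)%N)
  (alpha_ : 'I_m -> R) (T_ : 'I_m -> H -> H)
  (alpha_lt1 : forall i, alpha_ i < 1)
  (T_spc : forall i, strict_pseudocontraction (alpha_ i) (T_ i))
  (w : 'I_m -> R) (w_gt0 : forall i, 0 < w i)
  (w_sum1 : \sum_(i < m) w i = 1) :
  let T : H -> H := fun x => \sum_(i < m) w i *: T_ i x in
  let alpha : R := 1 - (\sum_(i < m) w i / (1 - alpha_ i))^-1 in
  strict_pseudocontraction alpha T /\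
  [/\ (-oo < \big[mine/+oo]_(i < m) (alpha_ i)%:E)%E,
      (\big[mine/+oo]_(i < m) (alpha_ i)%:E <= alpha%:E)%E,
      (alpha%:E <= \big[maxe/-oo]_(i < m) (alpha_ i)%:E)%E
    & (\big[maxe/-oo]_(i < m) (alpha_ i)%:E < 1)%E].
Proof.
move=> T alpha.
pose b i : R := 1 - alpha_ i.
have b_gt0 i : 0 < b i by rewrite subr_gt0.
have [imax le_imax] := @exists_ge_wavg R _ w (fun i => (b i)^-1) w_gt0 w_sum1.
have [imin le_imin] := @exists_le_wavg R _ w (fun i => (b i)^-1) w_gt0 w_sum1.
have S_gt0 : 0 < \sum_(i < m) w i / b i.
  by apply: lt_le_trans le_imin; rewrite invr_gt0.
split; last split.
- apply/strict_pseudocontractionP; split=> [|x y].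
    by rewrite ltrBlDr ltrDl invr_gt0.
  pose r i := (T_ i x - x) - (T_ i y - y).
  have rE : (T x - x) - (T y - y) = \sum_(i < m) w i *: r i.
    under eq_bigr do rewrite /r !scalerBr.
    by rewrite !sumrB -!scaler_suml w_sum1 !scale1r.
  have r_spc i : w i * (b i * `|r i| ^+ 2 + 2 * inner (x - y) (r i)) <= 0.
    have /strict_pseudocontractionP[_ /(_ x y) spc_i] := T_spc i.
    by rewrite pmulr_rle0.
  have := sqr_norm_wsum_le _ _ _ w b r (fun i => ltW (w_gt0 i)) b_gt0.
  have : \sum_(i < m) w i * (b i * `|r i| ^+ 2 + 2 * inner (x - y) (r i)) <= 0.
    exact: sumr_le0.
  under eq_bigr do rewrite mulrDr mulrA (mulrCA _ 2).
  rewrite big_split /= -mulr_sumr.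
  have -> : \sum_(i < m) w i * inner (x - y) (r i)
      = inner (x - y) (\sum_(i < m) w i *: r i).
    by rewrite linear_sumr; apply: eq_bigr => i _; rewrite linearZr_LR.
  rewrite rE subKr; lra.
- by apply/bigmin_gtP; split=> [|i _]; rewrite ?ltNyr ?ltNy0.
- apply: le_trans (bigmin_le_cond _ _ (isT : xpredT imin)) _.
  rewrite lee_fin lerBrDl -lerBrDr -/(b imin) -[b imin]invrK.
  by rewrite lef_pV2 ?posrE ?invr_gt0.
- apply: le_trans (le_bigmax_cond _ _ (isT : xpredT imax)).
  rewrite lee_fin lerBlDl -lerBlDr -/(b imax) -[b imax]invrK.
  by rewrite lef_pV2 ?posrE ?invr_gt0.
- by apply/bigmax_ltP; split=> [|i _]; rewrite ?ltNyr // lte_fin.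
Qed.
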